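(* Let $x_0\in\mathbb{R}^p$, let $J:\mathbb{R}^p\to[0,+\infty)$ be a finite-valued convex function, and let $\mathcal{M}\subset\mathbb{R}^p$ be a set containing $x_0$ such that $J$ is locally partly smooth at $x_0$ relative to $\mathcal{M}$. Write $T=T_{x_0}$, and let $\tilde\Gamma\in\mathbb{R}^{p\times p}$. Suppose that $x_0$ is the unique solution of $$\min_{x\in\mathbb{R}^p}\ J(x)\quad\text{subject to}\quad \tilde\Gamma x=\tilde\Gamma x_0,$$ and that $$\ker(\tilde\Gamma)\cap T=\{0\}\quad\text{and}\quad \eta_{\tilde\Gamma}\notin\partial J(x_0).$$ Then there exists $C>0$ such that, for every canonical parameter $\theta=(\mu,u,\Gamma)$ with $\mu>0$ and with $\varepsilon=u-\Gamma x_0$, if $$\max\left(\|\Gamma-\tilde\Gamma\|,\ \|\varepsilon\|\mu^{-1},\ \mu\right)\le C,$$ then any solution $x_\theta$ of $(\mathcal{P}_\theta)$ satisfies $x_\theta\notin\mathcal{M}$.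
   Context: Observation model and canonical parameters: $y=\Phi x_0+w$ with $\Phi\in\mathbb{R}^{n\times p}$ (for some $n\ge1$), $w\in\mathbb{R}^n$, and $\lambda>0$ a regularization parameter. The canonical parameters are $\theta=(\mu,u,\Gamma)=\left(\frac{\lambda}{n},\frac{\Phi^*y}{n},\frac{\Phi^*\Phi}{n}\right)$ and $\varepsilon=\frac{\Phi^*w}{n}=u-\Gamma x_0$. In particular $\Gamma$ is symmetric positive semidefinite and $u\in\mathrm{Im}(\Gamma)$. Problem $(\mathcal{P}_\theta)$ for $\mu>0$: $$\min_{x\in\mathbb{R}^p}\ J(x)+\frac{1}{2\mu}\langle\Gamma x,x\rangle-\frac1\mu\langle x,u\rangle+\frac{1}{2\mu}\langle\Gamma^+u,u\rangle ,$$ where $A^+$ is the Moore–Penrose pseudo-inverse of $A$. It is equivalent to minimizing $J(x)+\frac{1}{2\lambda}\|\Phi x-y\|^2$. Notation: $\partial J$ is the convex subdifferential. For a convex set $\mathcal{C}$, $\mathrm{VecHull}(\mathcal{C})=\{\rho(x-x'):(x,x')\in\mathcal{C}^2,\rho\in\mathbb{R}\}$ and its linear span is the subspace parallel to the affine hull of $\mathcal{C}$. The tangent model subspace at $x$ is $T_x=\mathrm{VecHull}(\partial J(x))^\perp$. $P_T$ is the orthogonal projection onto a subspace $T$, and $\Gamma_T=P_T\Gamma P_T$. With $T=T_{x_0}$, the vector $e=P_T(\partial J(x_0))$ is well defined (the projection onto $T$ of any element of $\partial J(x_0)$). For a matrix $\tilde\Gamma$ with $\ker(\tilde\Gamma)\cap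 T=\{0\}$, the linearized pre-certificate is $\eta_{\tilde\Gamma}=\tilde\Gamma\,\tilde\Gamma_T^+e$. Partial smoothness: a finite-valued convex function $J$ is partly smooth at $x$ relative to a set $\mathcal{M}$ containing $x$ if (i) $\mathcal{M}$ is a $C^2$-manifold (embedded in $\mathbb{R}^p$) around $x$ and $J$ restricted to $\mathcal{M}$ is $C^2$ around $x$; (ii) the tangent space of $\mathcal{M}$ at $x$ is $T_x$; (iii) the set-valued mapping $\partial J$ is continuous at $x$ relative to $\mathcal{M}$ (equivalently, since $J$ is finite convex: for any sequence $x_n\in\mathcal{M}$ with $x_n\to x$ and any $\eta\in\partial J(x)$, there exist $\eta_n\in\partial J(x_n)$ with $\eta_n\to\eta$). $J$ is locally partly smooth at $x$ relative to $\mathcal{M}$ if $\mathcal{M}$ is a manifold and there is a neighbourhood $U$ of $x$ such that $J$ is partly smooth at every $x'\in\mathcal{M}\cap U$ relative to $\mathcal{M}$. *)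

(* Defs.v *)
From HB Require Import structures.
From mathcomp Require Import all_boot all_order all_algebra.
From mathcomp Require Import all_classical all_reals all_analysis.

Set Implicit Arguments.
Unset Strict Implicit.
Unset Printing Implicit Defensive.

Import Order.TTheory GRing.Theory Num.Theory.
Import numFieldNormedType.Exports.

Local Open Scope classical_set_scope.
Local Open Scope ring_scope.

(* Vectors of R^p are columns 'cV[R]_p. The library norm on matrices is the sup
   norm; it is used only through the topology it induces, and the norms that
   occur in quantitative bounds are the Euclidean and the operator norm below. *)

Section EuclideanGeometry.
Context {R : realType}.

Definition dot {p : nat} (x y : 'cV[R]_p) : R := \sum_i x i 0 * y i 0.

Definition norm2 {p : nat} (x : 'cV[R]_p) : R := Num.sqrt (dot x x).

Definition opnorm {m p : nat} (A : 'M[R]_(m, p)) : R :=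
  sup [set norm2 (A *m x) | x in [set x : 'cV[R]_p | norm2 x <= 1]].

Definition orth {p : nat} (S : set 'cV[R]_p) : set 'cV[R]_p :=
  [set v | forall w, S w -> dot w v = 0].

Definition is_orth_proj {p : nat} (T : set 'cV[R]_p) (P : 'M[R]_p) : Prop :=
  forall v, T (P *m v) /\ (forall w, T w -> dot w (v - P *m v) = 0).

Definition orth_proj {p : nat} (T : set 'cV[R]_p) : 'M[R]_p :=
  get (is_orth_proj T).

Definition is_mpinv {m p : nat} (A : 'M[R]_(m, p)) (B : 'M[R]_(p, m)) : Prop :=
  [/\ A *m B *m A = A, B *m A *m B = B,
      (A *m B)^T = A *m B & (B *m A)^T = B *m A].

Definition mpinv {m p : nat} (A : 'M[R]_(m, p)) : 'M[R]_(p, m) :=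
  get (is_mpinv A).

Lemma dotE {p : nat} (x y : 'cV[R]_p) : dot x y = (x^T *m y) 0 0.
Proof. by rewrite mxE; apply: eq_bigr => i _; rewrite mxE. Qed.

(* [mpinvP] and [orth_projP] show that the matrices chosen above do exist;
   [orth_projP] covers every subspace, written as an orthogonal complement. *)

Lemma dot_eq0 {p : nat} (x : 'cV[R]_p) : dot x x = 0 -> x = 0.
Proof.
move=> /eqP; rewrite psumr_eq0 => [/allP xx0|i _]; last by rewrite -expr2 sqr_ge0.
apply/colP => i; rewrite [RHS]mxE; have := xx0 i (mem_index_enum i).
by rewrite /= -expr2 sqrf_eq0 => /eqP.
Qed.

Lemma gram_unitmx {r n : nat} (F : 'M[R]_(r, n)) :
  row_free F -> F *m F^T \in unitmx.
Proof.
move=> freeF; rewrite -row_free_unit; apply: inj_row_free => v vFF0.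
suff /dot_eq0 /(congr1 trmx) : dot (v *m F)^T (v *m F)^T = 0.
  by rewrite trmxK trmx0 => vF0; apply: (row_free_inj freeF); rewrite vF0 mul0mx.
by rewrite dotE trmxK trmx_mul mulmxA -(mulmxA v) vFF0 mul0mx mxE.
Qed.

Lemma mpinvP {m p : nat} (A : 'M[R]_(m, p)) : is_mpinv A (mpinv A).
Proof.
apply: (@getPex _ (is_mpinv A)).
have [r [C [F [eA uC uF]]]] : exists r (C : 'M[R]_(m, r)) (F : 'M[R]_(r, p)),
    [/\ C *m F = A, C^T *m C \in unitmx & F *m F^T \in unitmx].
  exists (\rank A), (col_base A), (row_base A); split; first exact: mulmx_base.
    rewrite -[X in _ *m X]trmxK; apply: gram_unitmx.
    by rewrite /row_free mxrank_tr; exact: col_base_full.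
  exact/gram_unitmx/row_base_free.
pose X := invmx (F *m F^T); pose Y := invmx (C^T *m C).
have symX : X^T = X by rewrite /X trmx_inv trmx_mul trmxK.
have symY : Y^T = Y by rewrite /Y trmx_inv trmx_mul trmxK.
exists (F^T *m X *m (Y *m C^T)).
have eAB : A *m (F^T *m X *m (Y *m C^T)) = C *m Y *m C^T.
  by rewrite -eA -!mulmxA (mulmxA F) (mulmxA (F *m F^T)) mulmxV// mul1mx.
have eBA : F^T *m X *m (Y *m C^T) *m A = F^T *m X *m F.
  by rewrite -eA -!mulmxA (mulmxA C^T) (mulmxA Y) mulVmx// mul1mx.
split.
- by rewrite eAB -eA -!mulmxA (mulmxA C^T) (mulmxA Y) mulVmx// mul1mx.
- by rewrite eBA -!mulmxA (mulmxA F) (mulmxA X (F *m _)) mulVmx// mul1mx.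
- by rewrite eAB !trmx_mul trmxK symY mulmxA.
- by rewrite eBA !trmx_mul trmxK symX mulmxA.
Qed.

Lemma orth_projP {p : nat} (S : set 'cV[R]_p) :
  is_orth_proj (orth S) (orth_proj (orth S)).
Proof.
apply: (@getPex _ (is_orth_proj (orth S))).
pose Q n := `[< exists2 B : 'M[R]_p,
  forall z, orth S z -> B *m z = 0 & \rank B = n >].
have exQ : exists n, Q n.
  by exists 0%N; apply/asboolP; exists 0; rewrite ?mxrank0// => z _; rewrite mul0mx.
have leQ n : Q n -> (n <= p)%N by move=> /asboolP[B _ <-]; exact: rank_leq_row.
have [r /asboolP[B Bz rB] maxr] := ex_maxnP exQ leQ.
have orthE z : orth S z <-> B *m z = 0.
  split=> [/Bz//|Bz0 w Sw]; rewrite dotE.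
  have sub : (w^T <= B)%MS.
    have : (B + w^T <= B)%MS.
      rewrite -(geq_leqif (mxrank_leqif_sup (addsmxSl _ _))) rB.
      apply: maxr; apply/asboolP; exists (B + w^T)%MS => // v Sv.
      have /sub_addsmxP[u ->] := submx_refl (B + w^T)%MS.
      rewrite mulmxDl -!mulmxA Bz// mulmx0 add0r.
      by rewrite [w^T *m v]mx11_scalar -dotE Sv// mul_mx_scalar scale0r.
    by apply: submx_trans; exact: addsmxSr.
  by have /submxP[D ->] := sub; rewrite -mulmxA Bz0 mulmx0 mxE.
have [BKB _ _ symKB] := mpinvP B.
exists (1%:M - mpinv B *m B) => v; split.
  by apply/orthE; rewrite mulmxBl mul1mx mulmxBr !mulmxA BKB subrr.
move=> w /orthE Bw0; rewrite mulmxBl mul1mx opprB addrC subrK dotE -symKB.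
by rewrite mulmxA -trmx_mul -mulmxA Bw0 mulmx0 trmx0 mul0mx mxE.
Qed.

End EuclideanGeometry.

Section ConvexAnalysis.
Context {R : realType} {p : nat}.
Implicit Types (J : 'cV[R]_p -> R) (C D M : set 'cV[R]_p) (x : 'cV[R]_p).

Definition argmin D (f : 'cV[R]_p -> R) : set 'cV[R]_p :=
  [set x | D x /\ forall z, D z -> f x <= f z].

Definition subdiff J x : set 'cV[R]_p :=
  [set eta | forall z, J x + dot eta (z - x) <= J z].

Definition vechull C : set 'cV[R]_p :=
  [set v | exists x, exists x', exists rho : R,
    [/\ C x, C x' & v = rho *: (x - x')]].

Definition model_space J x : set 'cV[R]_p := orth (vechull (subdiff J x)).

Definition model_vector J x : 'cV[R]_p :=
  get [set orth_proj (model_space J x) *m eta | eta in subdiff J x].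

(* The projection onto [model_space J x] does not depend on the subgradient. *)
Lemma model_vectorE J x eta : subdiff J x eta ->
  model_vector J x = orth_proj (model_space J x) *m eta.
Proof.
set T := model_space J x; set P := orth_proj T => Jeta.
have PT : is_orth_proj T P by exact: orth_projP.
have [|zeta Jzeta eq_zeta] := @getPex _ [set P *m z | z in subdiff J x].
  by exists (P *m eta); exists eta.
rewrite /model_vector -/T -/P -eq_zeta.
apply/eqP; rewrite -subr_eq0 -mulmxBr; apply/eqP.
set d := zeta - eta; have [Td dP] := PT d.
apply: dot_eq0.
have := dP _ Td; rewrite dotE mulmxBr mxE [X in _ + X]mxE -!dotE.
rewrite [dot (P *m d) d](_ : _ = 0) ?sub0r.
  by move=> /eqP; rewrite oppr_eq0 => /eqP.
rewrite (_ : dot _ _ = dot d (P *m d)); last by apply: eq_bigr => i _; rewrite mulrC.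
by apply: Td; exists zeta, eta, 1; split; rewrite ?scale1r.
Qed.

Definition linearized_precertificate J x (Gt : 'M[R]_p) : 'cV[R]_p :=
  let P := orth_proj (model_space J x) in
  Gt *m mpinv (P *m Gt *m P) *m model_vector J x.

End ConvexAnalysis.

Section PartialSmoothness.
Context {R : realType}.

Fixpoint Ck {V W : normedModType R} (k : nat) (U : set V) (f : V -> W) : Prop :=
  if k is k'.+1 then
    (forall x, U x -> differentiable f x) /\ (forall v, Ck k' U ('D_v f))
  else forall x, U x -> {for x, continuous f}.

(* Near x, M is the zero set of the C^2 map F with values in R^k, whose
   differential at x is onto: M is a C^2-manifold of codimension k around x. *)
Definition local_equation {p k : nat} (M : set 'cV[R]_p) (x : 'cV[R]_p)
    (F : 'cV[R]_p -> 'cV[R]_k) : Prop :=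
  exists U : set 'cV[R]_p,
    [/\ open U /\ U x, Ck 2 U F,
        forall w, exists v, 'd F x v = w
      & forall z, U z -> (M z <-> F z = 0)].

Definition manifold_around {p : nat} (M : set 'cV[R]_p) (x : 'cV[R]_p) : Prop :=
  M x /\ exists k, exists F : 'cV[R]_p -> 'cV[R]_k, local_equation M x F.

Definition manifold {p : nat} (M : set 'cV[R]_p) : Prop :=
  forall x, M x -> manifold_around M x.

(* The kernel of the differential does not depend on the local equation. *)
Definition is_tangent_space {p : nat} (M : set 'cV[R]_p) (x : 'cV[R]_p)
    (T : set 'cV[R]_p) : Prop :=
  exists k, exists F : 'cV[R]_p -> 'cV[R]_k,
    local_equation M x F /\ T = [set v | 'd F x v = 0].

Definition C2_along {p : nat} (M : set 'cV[R]_p) (x : 'cV[R]_p)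
    (J : 'cV[R]_p -> R) : Prop :=
  exists U : set 'cV[R]_p, exists g : 'cV[R]_p -> R,
    [/\ open U, U x, Ck 2 U g & forall z, U z -> M z -> J z = g z].

(* Sequential inner semicontinuity. The subdifferential of a finite convex
   function is always outer semicontinuous, so this is its continuity at x
   relative to M. *)
Definition subdiff_continuous_along {p : nat} (M : set 'cV[R]_p)
    (x : 'cV[R]_p) (J : 'cV[R]_p -> R) : Prop :=
  forall (xs : nat -> 'cV[R]_p) (eta : 'cV[R]_p),
    (forall i, M (xs i)) -> xs @ \oo --> x -> subdiff J x eta ->
    exists etas : nat -> 'cV[R]_p,
      (forall i, subdiff J (xs i) (etas i)) /\ etas @ \oo --> eta.

Definition partly_smooth {p : nat} (J : 'cV[R]_p -> R) (M : set 'cV[R]_p)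
    (x : 'cV[R]_p) : Prop :=
  [/\ manifold_around M x /\ C2_along M x J,
      is_tangent_space M x (model_space J x)
    & subdiff_continuous_along M x J].

Definition locally_partly_smooth {p : nat} (J : 'cV[R]_p -> R)
    (M : set 'cV[R]_p) (x : 'cV[R]_p) : Prop :=
  manifold M /\
  exists2 U : set 'cV[R]_p, nbhs x U &
    forall z, M z -> U z -> partly_smooth J M z.

End PartialSmoothness.

Section InverseProblem.
Context {R : realType} {p : nat}.

Definition canonical_parameter (x0 : 'cV[R]_p)
    (mu : R) (u : 'cV[R]_p) (G : 'M[R]_p) : Prop :=
  exists (n : nat) (Phi : 'M[R]_(n, p)) (w : 'cV[R]_n) (lambda : R),
    let y := Phi *m x0 + w in
    [/\ (0 < n)%N /\ 0 < lambda, mu = lambda / n%:R,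
        u = n%:R^-1 *: (Phi^T *m y) & G = n%:R^-1 *: (Phi^T *m Phi)].

Definition objective (J : 'cV[R]_p -> R) (mu : R) (u : 'cV[R]_p)
    (G : 'M[R]_p) (x : 'cV[R]_p) : R :=
  J x + (2 * mu)^-1 * dot (G *m x) x - mu^-1 * dot x u
    + (2 * mu)^-1 * dot (mpinv G *m u) u.

End InverseProblem.

(* Main.v *)
Require Import Defs.
From mathcomp Require Import all_boot all_order all_algebra.
From mathcomp Require Import all_classical all_reals all_analysis.
From mathcomp Require Import ring lra.

(* Suppose that solutions x_t of (P_theta) lie in M for parameters approaching
   the limit, and take all limits along an ultrafilter, so that bounded families
   of vectors converge. With d = x - x0 and eps = u - Gamma x0, optimality says
   that eta = eps / mu - Gamma (d / mu) is a subgradient of J at x. Uniqueness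
   of x0 gives d -> 0. As x and x0 both lie in M, every limit of rescaled
   displacements c d lies in the tangent space T of M at x0. Subgradients near
   x0 are bounded and ker Gt meets T trivially, hence d / mu is bounded and
   converges to some v in T. The limit - Gt v of the eta is then a subgradient
   of J at x0, so its projection onto T is e, and this forces it to be the
   linearized pre-certificate. *)

Set Implicit Arguments.
Unset Strict Implicit.
Unset Printing Implicit Defensive.

Import Order.TTheory GRing.Theory Num.Theory.
Import numFieldNormedType.Exports.
Local Open Scope classical_set_scope.
Local Open Scope ring_scope.

(** * Limits of matrices along filters and ultrafilters *)

Section Limits.
Context {R : realType} {T : Type} (F : set_system T).

Lemma cvg_mx {FF : Filter F} m n (f : T -> 'M[R]_(m, n)) (l : 'M[R]_(m, n)) :
  (forall i j, f t i j @[t --> F] --> l i j) -> f @ F --> l.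
Proof.
move=> fl A [P Pl PA].
suff : \forall t \near F, forall i j, P i j (f t i j) by apply: filterS => t /PA.
apply: filter_forall => i; apply: filter_forall => j.
exact: (fl i j) (Pl i j).
Qed.

Lemma cvg_coord {FF : Filter F} m n (f : T -> 'M[R]_(m, n)) (l : 'M[R]_(m, n)) i j :
  f @ F --> l -> f t i j @[t --> F] --> l i j.
Proof. by move=> fl; exact: (cvg_comp _ _ fl (@coord_continuous R m n i j l)). Qed.

Lemma cvg_mulmx {FF : Filter F} m n q (f : T -> 'M[R]_(m, n)) (g : T -> 'M[R]_(n, q))
    (k : 'M[R]_(m, n)) (l : 'M[R]_(n, q)) :
  f @ F --> k -> g @ F --> l -> f t *m g t @[t --> F] --> k *m l.
Proof.
move=> fk gl; apply: cvg_mx => i j; rewrite mxE; under eq_fun do rewrite mxE.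
by apply: (cvg_big add_continuous) => h _; apply: cvgM; exact: cvg_coord.
Qed.

Lemma cvg_dot {FF : Filter F} p (f g : T -> 'cV[R]_p) (k l : 'cV[R]_p) :
  f @ F --> k -> g @ F --> l -> dot (f t) (g t) @[t --> F] --> dot k l.
Proof.
move=> fk gl; apply: (cvg_big add_continuous) => h _.
by apply: cvgM; exact: cvg_coord.
Qed.

Lemma ler_cvg_near {FF : ProperFilter F} (f g : T -> R) (k l : R) :
  f @ F --> k -> g @ F --> l -> (\forall t \near F, f t <= g t) -> k <= l.
Proof.
move=> fk gl fg; rewrite leNgt; apply/negP => lk.
have e0 : 0 < (k - l) / 2 by rewrite divr_gt0// subr_gt0.
have /cvgrPdist_lt/(_ _ e0) fk' := fk; have /cvgrPdist_lt/(_ _ e0) gl' := gl.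
have [t /= [? []]] := filter_ex (filterI fg (filterI fk' gl')).
by rewrite !ltr_norml => /andP[_ ?] /andP[? _]; lra.
Qed.

(** An ultrafilter contains each set or its complement, so a cluster point of the image is already a
    limit. This takes the place of extracting convergent subsequences. *)
Lemma ultra_compact_cvg {FU : UltraFilter F} {X : topologicalType} (K : set X) (f : T -> X) :
  compact K -> (\forall t \near F, K (f t)) -> exists l : X, f @ F --> l.
Proof.
move=> cK Kf; have [l [_ cl]] := cK (f @ F) _ Kf.
exists l => A lA; have [//|FnA] := in_ultra_setVsetC (f @^-1` A) FU.
by have [x []] := cl (~` A) A FnA lA.
Qed.

Lemma mx_entry_le_norm m n (x : 'M[R]_(m, n)) i j : `|x i j| <= `|x|.
Proof.
by rewrite [leRHS]/Num.norm/= mx_normrE; apply/bigmax_geP; right; exists (i, j).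
Qed.

Lemma mx_norm_le m n (x : 'M[R]_(m, n)) b :
  0 <= b -> (forall i j, `|x i j| <= b) -> `|x| <= b.
Proof.
by move=> b0 xb; rewrite [leLHS]/Num.norm/= mx_normrE; apply/bigmax_leP; split.
Qed.

(** Each entry eventually stays in a compact segment, hence converges along the ultrafilter. *)
Lemma ultra_bounded_cvg {FU : UltraFilter F} m n (f : T -> 'M[R]_(m, n)) (b : R) :
  (\forall t \near F, `|f t| <= b) -> exists l : 'M[R]_(m, n), f @ F --> l.
Proof.
move=> fb.
have /choice[l lP] (ij : 'I_m * 'I_n) : exists l : R, f t ij.1 ij.2 @[t --> F] --> l.
  apply: (@ultra_compact_cvg _ _ `[- b, b]); first exact: segment_compact.
  apply: filterS fb => t ftb; rewrite /= in_itv/= -ler_norml.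
  exact: le_trans (mx_entry_le_norm _ _ _) ftb.
exists (\matrix_(i, j) l (i, j)); apply: cvg_mx => i j; rewrite mxE.
exact: lP (i, j).
Qed.

End Limits.

(** * The dot product, comparison of norms, and semidefinite forms *)

Section DotAndNorms.
Context {R : realType}.

Lemma dotC p (x y : 'cV[R]_p) : dot x y = dot y x.
Proof. by apply: eq_bigr => i _; rewrite mulrC. Qed.

Lemma dotDr p (x y z : 'cV[R]_p) : dot x (y + z) = dot x y + dot x z.
Proof. by rewrite !dotE mulmxDr mxE. Qed.

Lemma dotZr p (x y : 'cV[R]_p) a : dot x (a *: y) = a * dot x y.
Proof. by rewrite !dotE -scalemxAr mxE. Qed.

Lemma dotNr p (x y : 'cV[R]_p) : dot x (- y) = - dot x y.
Proof. by rewrite !dotE mulmxN mxE. Qed.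

Lemma dotBr p (x y z : 'cV[R]_p) : dot x (y - z) = dot x y - dot x z.
Proof. by rewrite dotDr dotNr. Qed.

Lemma dotDl p (x y z : 'cV[R]_p) : dot (x + y) z = dot x z + dot y z.
Proof. by rewrite dotC dotDr !(dotC z). Qed.

Lemma dotZl p (x y : 'cV[R]_p) a : dot (a *: x) y = a * dot x y.
Proof. by rewrite dotC dotZr (dotC y). Qed.

Lemma dotNl p (x y : 'cV[R]_p) : dot (- x) y = - dot x y.
Proof. by rewrite dotC dotNr (dotC y). Qed.

Lemma dotBl p (x y z : 'cV[R]_p) : dot (x - y) z = dot x z - dot y z.
Proof. by rewrite dotDl dotNl. Qed.

Lemma dot_mulmxl m n (A : 'M[R]_(m, n)) x y : dot (A *m x) y = dot x (A^T *m y).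
Proof. by rewrite !dotE trmx_mul mulmxA. Qed.

Lemma dot_ge0 p (x : 'cV[R]_p) : 0 <= dot x x.
Proof. by apply: sumr_ge0 => i _; rewrite -expr2 sqr_ge0. Qed.

(** Together with [norm_le_opnorm], this transfers the Euclidean and operator norm bounds of the
    theorem to the sup norm, which carries the topology. *)
Lemma norm_le_norm2 p (x : 'cV[R]_p) : `|x| <= norm2 x.
Proof.
apply: mx_norm_le => [|i j]; first exact: sqrtr_ge0.
rewrite -(@ger0_norm _ (norm2 x)) ?sqrtr_ge0// -ler_sqr ?nnegrE// -!normrX.
rewrite !ger0_norm ?sqr_ge0// sqr_sqrtr ?dot_ge0// /dot (bigD1 i)//= ord1 -expr2.
by rewrite lerDl sumr_ge0// => k _; rewrite -expr2 sqr_ge0.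
Qed.

Lemma norm_le_opnorm m p (A : 'M[R]_(m, p)) : `|A| <= opnorm A.
Proof.
have sA : has_sup [set norm2 (A *m x) | x in [set x : 'cV[R]_p | norm2 x <= 1]].
  split.
    exists (norm2 (A *m 0)); exists 0 => //=.
    by rewrite /norm2 dotE mulmx0 mxE sqrtr0 ler01.
  (* The entries of [x] are at most 1 in absolute value, so each entry of [A *m x] is at most the
     sum of the absolute values of its row of [A]. *)
  exists (Num.sqrt (\sum_i (\sum_j `|A i j|) ^+ 2)) => _ [x x1 <-].
  apply: ler_wsqrtr; apply: ler_sum => i _; rewrite -expr2 -real_normK ?num_real//.
  rewrite lerXn2r ?nnegrE ?sumr_ge0// mxE.
  apply: (le_trans (ler_norm_sum _ _ _)); apply: ler_sum => j _; rewrite normrM.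
  rewrite ler_piMr//; apply: le_trans (mx_entry_le_norm _ _ _) _.
  exact: le_trans (norm_le_norm2 _) x1.
have Ax x : norm2 x <= 1 -> norm2 (A *m x) <= opnorm A.
  by move=> x1; apply: sup_upper_bound => //; exists x.
apply: mx_norm_le => [|i j].
  by apply: le_trans (Ax 0 _); rewrite /norm2 ?sqrtr_ge0// dotE mulmx0 mxE sqrtr0 ler01.
(* An entry of [A] is a coordinate of the image of a basis vector, which has Euclidean norm 1. *)
have -> : A i j = (A *m delta_mx j (0 : 'I_1)) i 0 by rewrite -colE mxE.
apply: le_trans (mx_entry_le_norm _ _ _) _; apply: le_trans (norm_le_norm2 _) _.
by apply: Ax; rewrite /norm2 dotE trmx_delta mul_delta_mx mxE !eqxx sqrtr1.
Qed.

(** Moving from [v] in the direction [- (A *m v)] would make the form negative unless [A *m v]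
    vanishes. *)
Lemma psd_dot_eq0 p (A : 'M[R]_p) (v : 'cV[R]_p) : A^T = A ->
  (forall w, 0 <= dot (A *m w) w) -> dot (A *m v) v <= 0 -> A *m v = 0.
Proof.
move=> sA psdA v0; apply: dot_eq0.
set a := dot _ _; pose b := dot (A *m (A *m v)) (A *m v).
have b0 : 0 <= b by exact: psdA.
have a0 : 0 <= a by exact: dot_ge0.
(* At [v + t *: (A *m v)] the form is at most [2 * t * a + t ^+ 2 * b], and this [t] makes that
   bound negative unless [a] is 0. The shift by 1 keeps the denominator positive when [b] is 0. *)
pose t := - (a / (b + 1)).
have := psdA (v + t *: (A *m v)).
rewrite mulmxDr -scalemxAr !(dotDl, dotDr, dotZl, dotZr) -/a -/b.
have -> : dot (A *m (A *m v)) v = a by rewrite dot_mulmxl sA.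
move=> h; have {h v0} : 0 <= 2 * t * a + t ^+ 2 * b by lra.
have -> : 2 * t * a + t ^+ 2 * b = - (a ^+ 2 * ((b + 2) / (b + 1) ^+ 2)).
  by rewrite /t; field; rewrite gt_eqF// ltr_wpDl.
rewrite oppr_ge0 pmulr_lle0; last by rewrite divr_gt0 ?exprn_gt0 ?ltr_wpDl.
by move=> h; apply/eqP; rewrite -sqrf_eq0 eq_le h sqr_ge0.
Qed.

End DotAndNorms.

(** * Finite convex functions: local Lipschitz bounds and subgradients *)

Section FiniteConvexFunctions.
Context {R : realType} {p : nat} (J : 'cV[R]_p -> R).
Hypothesis J_convex : convex_function setT J.

Lemma convex_le x y t : 0 <= t <= 1 ->
  J (t *: x + (1 - t) *: y) <= t * J x + (1 - t) * J y.
Proof.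
move=> t01; have := J_convex (Itv01 (proj1 (andP t01)) (proj2 (andP t01))).
by move=> /(_ x y); rewrite !inE; apply.
Qed.

Lemma convex_segment_bound v r : 0 < r ->
  exists b, forall t, `|t| <= r -> J (t *: v) <= b.
Proof.
move=> r0; exists (Num.max (J (r *: v)) (J (- r *: v))) => t.
rewrite ler_norml => /andP[lt tr].
pose s := (t + r) / (2 * r).
have s01 : 0 <= s <= 1 by rewrite ler_pdivlMr ?ler_pdivrMr; lra.
have -> : t *: v = s *: (r *: v) + (1 - s) *: (- r *: v).
  by rewrite !scalerA -scalerDl; congr (_ *: v); rewrite /s; field; rewrite gt_eqF.
apply: le_trans (convex_le _ _ s01) _; set m := Num.max _ _.
have : J (r *: v) <= m by rewrite le_max lexx.
have : J (- r *: v) <= m by rewrite le_max lexx orbT.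
by move: s01 => /andP[]; nra.
Qed.

(** By induction on the coordinates, the sum is the midpoint of twice its first term and twice the
    rest. The radius doubles at each step, so [r] has to stay general. *)
Lemma convex_box_bound (s : seq 'I_p) r : 0 < r ->
  exists b, forall c : 'I_p -> R, (forall i, `|c i| <= r) ->
    J (\sum_(i <- s) c i *: delta_mx i 0) <= b.
Proof.
elim: s r => [|i0 s IH] r r0.
  by exists (J 0) => c _; rewrite big_nil.
have [|b1 hb1] := @convex_segment_bound (delta_mx i0 0) (2 * r).
  by rewrite mulr_gt0.
have [|b2 hb2] := IH (2 * r); first by rewrite mulr_gt0.
have scale2 a : `|a| <= r -> `|2 * a| <= 2 * r.
  by move=> ar; rewrite normrM ger0_norm// ler_pM2l.
exists (2^-1 * b1 + (1 - 2^-1) * b2) => c cr; rewrite big_cons.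
rewrite (_ : _ + _ = 2^-1 *: ((2 * c i0) *: delta_mx i0 0) +
    (1 - 2^-1) *: \sum_(i <- s) (2 * c i) *: delta_mx i 0); last first.
  rewrite scaler_sumr scalerA; congr (_ + _).
    by congr (_ *: _); field.
  by apply: eq_bigr => i _; rewrite scalerA; congr (_ *: _); field.
apply: le_trans (convex_le _ _ _) _; first by lra.
have := hb1 _ (scale2 _ (cr i0)).
have := hb2 (fun i => 2 * c i) (fun i => scale2 _ (cr i)).
by lra.
Qed.

Lemma convex_ball_bound r : exists b, forall x, `|x| <= r -> J x <= b.
Proof.
have [|b hb] := @convex_box_bound (index_enum 'I_p) (Num.max r 1).
  by rewrite lt_max ltr01 orbT.
exists b => x xr.
have -> : x = \sum_i x i 0 *: delta_mx i 0.
  by rewrite {1}[x]matrix_sum_delta; apply: eq_bigr => i _; rewrite big_ord1.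
by apply: hb => i; rewrite le_max (le_trans (mx_entry_le_norm x i 0) xr).
Qed.

(** By convexity, the slope from [y] to [x] is at most the slope from [y] to a point further along
    the same ray. Bounds on [J] in a larger ball control the latter. *)
Lemma convex_ball_lipschitz r :
  exists2 b, 0 <= b & forall x y, `|x| <= r -> `|y| <= r -> J x <= J y + b * `|x - y|.
Proof.
have [m hm] := convex_ball_bound (3 * r).
(* The constant used for positive [r] divides by [2 * r]; here the ball contains at most the
   origin. *)
have [r0|r0] := leP r 0.
  exists 0 => // x y xr yr; rewrite mul0r addr0.
  have /eqP -> : x == 0 by rewrite -normr_le0 (le_trans xr).
  by have /eqP -> : y == 0 by rewrite -normr_le0 (le_trans yr).
(* The origin is the midpoint of [y] and [- y], so an upper bound at [- y] gives a lower bound at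
   [y]. *)
have low y : `|y| <= r -> 2 * J 0 - m <= J y.
  move=> yr; have hc : J 0 <= 2^-1 * J y + (1 - 2^-1) * J (- y).
    apply: le_trans (convex_le _ _ _); last by lra.
    rewrite scalerN -scalerBl (_ : _ - _ = 0) ?scale0r//; lra.
  have := hm (- y); rewrite normrN; have := normr_ge0 y; lra.
have b0 : 0 <= 2 * m - 2 * J 0.
  by have := low 0; have := hm 0; rewrite normr0; lra.
exists ((2 * m - 2 * J 0) / (2 * r)) => [|x y xr yr].
  by rewrite divr_ge0// mulr_ge0// ltW.
have [->|xy] := eqVneq x y; first by rewrite subrr normr0 mulr0 addr0.
have n0 : 0 < `|x - y| by rewrite normr_gt0 subr_eq0.
pose t := `|x - y| / (2 * r).
have t0 : 0 < t by rewrite divr_gt0 ?mulr_gt0.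
have t1 : t <= 1.
  by rewrite ler_pdivrMr ?mulr_gt0// mul1r (le_trans (ler_normB _ _))//; lra.
(* This point lies beyond [x] on the ray from [y], at distance [2 * r] from [y], hence in the ball
   of radius [3 * r]; [x] divides the segment from [y] to [z] in the ratio given by [t]. *)
pose z := y + t^-1 *: (x - y).
have Jz : J z <= m.
  apply: hm; apply: le_trans (ler_normD _ _) _.
  rewrite normrZ ger0_norm ?invr_ge0 ?(ltW t0)// /t invf_div -mulrA mulVf ?gt_eqF//.
  by lra.
have xE : x = t *: z + (1 - t) *: y.
  rewrite scalerDr scalerA mulfV ?gt_eqF// scale1r addrAC -scalerDl.
  by rewrite (addrC t) subrK scale1r addrC subrK.
rewrite {1}xE; apply: le_trans (convex_le _ _ _) _; first by rewrite ltW.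
have := low _ yr.
rewrite (_ : (2 * m - 2 * J 0) / (2 * r) * `|x - y| = t * (2 * m - 2 * J 0)); last first.
  by rewrite /t mulrAC -mulrA mulrC.
by nra.
Qed.

Lemma convex_continuous : continuous J.
Proof.
move=> x; apply/(@cvgrPdist_le _ _ _ (nbhs x)) => e e0.
have [b b0 lipb] := convex_ball_lipschitz (`|x| + 1).
have xr : `|x| <= `|x| + 1 by rewrite lerDl.
near=> y.
(* The bound 1 keeps [y] in the ball where [b] is a Lipschitz constant; [b + 1] avoids a division by
   0. *)
have yx : `|x - y| <= Num.min 1 (e / (b + 1)).
  near: y; apply: cvgr_dist_le => //.
  by rewrite lt_min ltr01 divr_gt0// ltr_wpDl.
move: yx; rewrite le_min => /andP[yx1 yxe].
have yr : `|y| <= `|x| + 1.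
  rewrite -[y](subKr x) (le_trans (ler_normB _ _))// lerD2l//.
have bxy : b * `|x - y| <= e.
  move: yxe; rewrite ler_pdivlMr ?ltr_wpDl// => yxe.
  by have := normr_ge0 (x - y); lra.
have := lipb _ _ xr yr; have := lipb _ _ yr xr; rewrite (distrC y x).
by rewrite ler_norml; lra.
Unshelve. all: by end_near. Qed.

(** Testing the subgradient inequality at [x + v] with [v] of norm at most 1 bounds [dot eta v] by a
    Lipschitz constant on the ball of radius [r + 1]. Basis vectors and their opposites then bound
    the entries of [eta]. *)
Lemma subgradient_bound r :
  exists b, forall x eta, `|x| <= r -> subdiff J x eta -> `|eta| <= b.
Proof.
have [b b0 lipb] := convex_ball_lipschitz (r + 1).
exists b => x eta xr Jeta; apply: mx_norm_le => // i j; rewrite ord1 {j}.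
have d1 : `|delta_mx i 0 : 'cV[R]_p| <= 1.
  by apply: mx_norm_le => // k l; rewrite mxE; case: (_ && _); rewrite ?normr1 ?normr0.
have step v : `|v| <= 1 -> dot eta v <= b.
  move=> v1; have xr' : `|x| <= r + 1 by rewrite ler_wpDr.
  have vr : `|x + v| <= r + 1 by rewrite (le_trans (ler_normD _ _))// lerD.
  have := lipb _ _ vr xr'; have := Jeta (x + v); rewrite addrAC subrr add0r.
  by have := ler_pM b0 (normr_ge0 v) (lexx b) v1; rewrite mulr1; lra.
have etaE : dot eta (delta_mx i 0) = eta i 0.
  by rewrite dotE -colE mxE mxE.
rewrite ler_norml; apply/andP; split; last by rewrite -etaE step.
by rewrite lerNl -etaE -dotNr step ?normrN.
Qed.

(** As [J] is continuous, the subgradient inequality at each fixed [z] passes to the limit. *)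
Lemma subdiff_closed {T} (F : set_system T) {FF : ProperFilter F}
    (x eta : T -> 'cV[R]_p) (x' eta' : 'cV[R]_p) :
  x @ F --> x' -> eta @ F --> eta' ->
  (\forall t \near F, subdiff J (x t) (eta t)) -> subdiff J x' eta'.
Proof.
move=> xx' ee' sub z.
have lim : J (x t) + dot (eta t) (z - x t) @[t --> F] --> J x' + dot eta' (z - x').
  apply: cvgD; first exact: (cvg_comp _ _ xx' (@convex_continuous x')).
  by apply: cvg_dot => //; apply: cvgB => //; exact: cvg_cst.
by apply: (ler_cvg_near lim (cvg_cst (J z))); apply: filterS sub => t; exact.
Qed.

End FiniteConvexFunctions.

(** * Optimality condition, limits of secants, and the linearized pre-certificate *)

Section OptimalityAndGeometry.
Context {R : realType}.

Lemma ge0_first_order (a b : R) :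
  (forall t, 0 < t <= 1 -> 0 <= t * a + t ^+ 2 * b) -> 0 <= a.
Proof.
move=> h; rewrite leNgt; apply/negP => a0.
have c0 : 0 < `|b| - a by rewrite subr_gt0 (lt_le_trans a0).
(* For negative [a] this lies in the allowed range of [t] and makes [a + t * b] negative. *)
pose t := - a / (`|b| - a).
have t0 : 0 < t by rewrite divr_gt0// oppr_gt0.
have := h t; rewrite t0 ler_pdivrMr// mul1r lerDr normr_ge0 => /(_ isT).
rewrite expr2 -mulrA -mulrDr pmulr_rge0// leNgt => /negP; apply.
have : t * b <= t * `|b| by rewrite ler_pM2l// ler_norm.
have : a + t * `|b| < 0.
  have -> : a + t * `|b| = - (a ^+ 2 / (`|b| - a)) by rewrite /t; field; rewrite gt_eqF.
  by rewrite oppr_lt0 divr_gt0// expr2 nmulr_rgt0.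
by lra.
Qed.

(** Comparing the objective at [x] and at [x + t *: (z - x)], with convexity used on [J] alone,
    leaves a linear term in [t], which is the subgradient inequality at [z], and a quadratic one,
    which [ge0_first_order] discards. *)
Lemma argmin_objective_subdiff p (J : 'cV[R]_p -> R) mu u (G : 'M[R]_p) x :
  convex_function setT J -> 0 < mu -> G^T = G ->
  argmin setT (objective J mu u G) x -> subdiff J x (mu^-1 *: (u - G *m x)).
Proof.
move=> convJ mu0 symG [_ minx] z; move zx : (z - x) => v.
rewrite -subr_ge0; apply: (@ge0_first_order _ ((2 * mu)^-1 * dot (G *m v) v)).
move=> t /andP[t0 t1].
have t01 : 0 <= t <= 1 by rewrite ltW.
have xtv : x + t *: v = t *: z + (1 - t) *: x.
  by rewrite -zx scalerBr scalerBl scale1r addrCA.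
have := minx (x + t *: v) I; have := convex_le convJ z x t01; rewrite -xtv.
have GxGv : dot (G *m v) x = dot (G *m x) v by rewrite dot_mulmxl symG dotC.
rewrite /objective mulmxDr -scalemxAr !(dotDl, dotDr, dotZl, dotZr, dotNl, dotNr) GxGv.
rewrite (dotC u v) invfM.
set Jt := J (x + _); set q := dot (G *m v) v; set l := dot _ v; set k := dot v u.
by lra.
Qed.

(** As [f] vanishes at [x] and at [x + d t], its differential at [d t] is negligible before [d t].
    Multiplying by [c t] preserves the estimate, and [c t *: d t] has a limit. *)
Lemma cvg_secant_tangent p k (M : set 'cV[R]_p) (x : 'cV[R]_p) (f : 'cV[R]_p -> 'cV[R]_k)
    {T} (F : set_system T) {FF : ProperFilter F} (d : T -> 'cV[R]_p) (c : T -> R) (w : 'cV[R]_p) :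
  local_equation M x f -> M x -> d @ F --> (0 : 'cV[R]_p) -> (\forall t \near F, M (x + d t)) ->
  c t *: d t @[t --> F] --> w -> 'd f x w = 0.
Proof.
move=> [U [[oU Ux] [dfU _] _ MU]] Mx d0 Md cdw.
have dfx : differentiable f x by exact: dfU.
have fx0 : f x = 0 by exact/MU.
have xdU : \forall t \near F, U (x + d t).
  have xd : x + d t @[t --> F] --> x.
    by rewrite -[X in _ --> X](addr0 x); apply: cvgD => //; exact: cvg_cst.
  by apply: xd; exact: open_nbhs_nbhs.
have dfcd : 'd f x (c t *: d t) @[t --> F] --> 'd f x w.
  by apply: continuous_cvg cdw; exact: (diff_continuous dfx).
suff small e : 0 < e -> `|'d f x w| <= e * `|w|.
  apply/eqP; rewrite -normr_le0; apply/ler_addgt0Pr => e e0; rewrite add0r.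
  apply: le_trans (small (e / (`|w| + 1)) _) _.
    by rewrite divr_gt0// ltr_wpDl.
  by rewrite mulrAC ler_pdivrMr ?ltr_wpDl// ler_pM2l// lerDl.
move=> e0; apply: (ler_cvg_near (cvg_norm dfcd) (cvgM (cvg_cst e) (cvg_norm cdw))).
have /eqaddoP/(_ e e0) fo := diff_locally dfx.
apply: filterS3 xdU Md (d0 _ fo) => t xdU Mxd.
rewrite /= /cst !fctE /= (addrC (d t)) (_ : f (x + d t) = 0); last exact/MU.
rewrite fx0 !add0r normrN => h.
rewrite linearZ/= !normrZ mulrCA; exact: ler_wpM2l.
Qed.

Lemma orth_proj_id p (S : set 'cV[R]_p) v : orth S v -> orth_proj (orth S) *m v = v.
Proof.
move=> Sv; have [SPv orthPv] := orth_projP S v.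
have Sd : orth S (v - orth_proj (orth S) *m v).
  by move=> w Sw; rewrite dotBr Sv// SPv// subrr.
by apply/esym/eqP; rewrite -subr_eq0; apply/eqP/dot_eq0/orthPv.
Qed.

(** The images of basis vectors are orthogonal to the residuals of basis vectors, which reads
    [P^T = P^T *m P], and the right side is symmetric. *)
Lemma orth_proj_sym p (S : set 'cV[R]_p) : (orth_proj (orth S))^T = orth_proj (orth S).
Proof.
set P := orth_proj _.
have PP : P^T = P^T *m P.
  apply/matrixP => i j; apply/eqP; rewrite -subr_eq0; apply/eqP.
  have [_ /(_ (P *m delta_mx i 0))] := orth_projP S (delta_mx j 0).
  rewrite -/P => /(_ _)/wrap[]; first by have [] := orth_projP S (delta_mx i 0).
  rewrite dot_mulmxl mulmxBr mulmxA dotBr !dotE !trmx_delta -!rowE -!colE !mxE.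
  by [].
by rewrite -[RHS]trmxK PP trmx_mul trmxK.
Qed.

(** With [A] the compression of [Gt] to the model space, the model vector is [- (A *m v)]. The
    vector [b] obtained from it by the pseudo-inverse lies in the model space and satisfies
    [A *m (b + v) = 0]. Semidefiniteness upgrades this to [Gt *m (b + v) = 0], so [b = - v] by the
    kernel condition. *)
Lemma linearized_precertificateE p (J : 'cV[R]_p -> R) x (Gt : 'M[R]_p) v :
  Gt^T = Gt -> (forall w, 0 <= dot (Gt *m w) w) ->
  [set v | Gt *m v = 0] `&` model_space J x = [set 0] ->
  model_space J x v -> subdiff J x (- (Gt *m v)) ->
  linearized_precertificate J x Gt = - (Gt *m v).
Proof.
move=> symG psdG kerG Tv Jv; rewrite /linearized_precertificate (model_vectorE Jv).
have Pid := @orth_proj_id _ (vechull (subdiff J x)).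
have PT := orth_projP (vechull (subdiff J x)).
have symP := orth_proj_sym (vechull (subdiff J x)).
rewrite -/(model_space J x) in Pid PT symP *.
set P := orth_proj _ in Pid PT symP *.
move AE : (P *m Gt *m P) => A.
have symA : A^T = A by rewrite -AE !trmx_mul symP symG mulmxA.
have [ABA BAB _ symBA] := mpinvP A; set B := mpinv A in ABA BAB symBA *.
have Pe : P *m - (Gt *m v) = - (A *m v).
  by rewrite mulmxN -AE -!mulmxA (Pid v Tv).
rewrite Pe -mulmxA; move bE : (B *m _) => b.
(* For symmetric [A] the range of the pseudo-inverse lies in that of [A], hence in the model
   space. *)
have BE : B = A *m B^T *m B by rewrite -{1}symA -trmx_mul symBA BAB.
have bT : model_space J x b.
  have -> : b = P *m (Gt *m P *m B^T *m b).
    by rewrite !mulmxA AE -bE mulmxA -BE.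
  by have [] := PT (Gt *m P *m B^T *m b).
have bvT : model_space J x (b + v) by move=> w Sw; rewrite dotDr bT// Tv// addr0.
have Abv : A *m (b + v) = 0.
  by rewrite mulmxDr -bE !mulmxN !mulmxA ABA addrC subrr.
have Gbv : Gt *m (b + v) = 0.
  apply: psd_dot_eq0 => //.
  rewrite -{1}(Pid _ bvT) -{2}(Pid _ bvT) dotC dot_mulmxl symP !mulmxA AE Abv.
  by rewrite dotE mulmx0 mxE.
have : [set 0] (b + v) by rewrite -kerG.
by move=> /eqP; rewrite addr_eq0 => /eqP ->; rewrite mulmxN.
Qed.

End OptimalityAndGeometry.

(** * The limit along an ultrafilter, with [a] standing for eps / mu and [d] for x - x0 *)

Section LimitingArgument.
Context {R : realType} {p : nat} {T : Type} (F : set_system T) {FU : UltraFilter F}.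
Context (J : 'cV[R]_p -> R) (x0 : 'cV[R]_p) (Gt : 'M[R]_p).
Hypothesis J_convex : convex_function setT J.
Context (mu : T -> R) (G : T -> 'M[R]_p) (a d : T -> 'cV[R]_p).
Hypothesis mu_gt0 : \forall t \near F, 0 < mu t.
Hypothesis mu0 : mu @ F --> (0 : R).
Hypothesis G_sym : \forall t \near F, (G t)^T = G t.
Hypothesis G_psd : \forall t \near F, forall w, 0 <= dot (G t *m w) w.
Hypothesis G_Gt : G @ F --> Gt.
Hypothesis a0 : a @ F --> (0 : 'cV[R]_p).
Hypothesis d_subdiff :
  \forall t \near F, subdiff J (x0 + d t) (a t - (mu t)^-1 *: (G t *m d t)).

Lemma limit_sym : Gt^T = Gt.
Proof.
apply/matrixP => i j; rewrite mxE.
have lim k l : G t k l @[t --> F] --> Gt k l by exact: cvg_coord.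
by apply/eqP; rewrite eq_le; apply/andP; split;
  [apply: (ler_cvg_near (lim j i) (lim i j)) | apply: (ler_cvg_near (lim i j) (lim j i))];
  apply: filterS G_sym => t /matrixP /(_ i j); rewrite mxE => ->.
Qed.

Lemma limit_psd w : 0 <= dot (Gt *m w) w.
Proof.
have lim : dot (G t *m w) w @[t --> F] --> dot (Gt *m w) w.
  apply: cvg_dot; last exact: cvg_cst.
  by apply: cvg_mulmx => //; exact: cvg_cst.
by apply: (ler_cvg_near (cvg_cst (0 : R)) lim); apply: filterS G_psd.
Qed.

Hypothesis J_ge0 : forall x, 0 <= J x.
Hypothesis x0_unique : argmin [set x | Gt *m x = Gt *m x0] J = [set x0].

(* Displacements longer than r are shortened to length r: convexity keeps the
   bounds, and a limit e' of them makes x0 + e' another minimiser. *)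
Lemma displacement_cvg0 : d @ F --> (0 : 'cV[R]_p).
Proof.
apply/cvgr0Pnorm_le => r r0.
(* If the displacements are not eventually of norm at most [r], they eventually exceed [r]. *)
have [//|far] := in_ultra_setVsetC [set t | `|d t| <= r] FU.
exfalso; pose s t := r / `|d t|; pose e t := s t *: d t.
have e_r : \forall t \near F, `|e t| = r.
  apply: filterS far => t /negP; rewrite -ltNge => dr.
  have d0 : 0 < `|d t| by exact: lt_trans dr.
  by rewrite normrZ ger0_norm ?divr_ge0 ?ltW// mulfVK ?gt_eqF.
have [e' ee'] : exists e' : 'cV[R]_p, e @ F --> e'.
  by apply: (@ultra_bounded_cvg _ _ _ _ _ _ _ r); apply: filterS e_r => t ->.
have s01 : \forall t \near F, 0 <= s t <= 1.
  apply: filterS far => t /negP; rewrite -ltNge => dr.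
  have d0 : 0 < `|d t| by exact: lt_trans dr.
  by rewrite /s divr_ge0 ?(ltW r0)//= ler_pdivrMr// mul1r ltW.
(* Both bounds come from the subgradient inequality tested at [x0] and scaled by [s t]. The first
   adds convexity between [x0] and [x0 + d t]; the second isolates the quadratic term, using that
   [J] is nonnegative and [s t] is at most 1. *)
have bounds : \forall t \near F, J (x0 + e t) <= J x0 + dot (a t) (e t) /\
    dot (G t *m e t) (e t) <= mu t * (J x0 + dot (a t) (e t)).
  apply: filterS (filterI s01 (filterI mu_gt0 (filterI G_psd d_subdiff))).
  move=> t [st [mt [/(_ (d t)) Gd /(_ x0)]]].
  rewrite opprD addNKr dotNr dotBl dotZl -/(e t) /e.
  rewrite -scalemxAr !dotZr dotZl.
  set q := dot (G t *m _) _ in Gd *; set l := dot (a t) _.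
  have -> : x0 + s t *: d t = s t *: (x0 + d t) + (1 - s t) *: x0.
    by rewrite scalerDr scalerBl scale1r addrAC (addrC (_ *: x0)) subrK.
  have := convex_le J_convex (x0 + d t) x0 st.
  move: st => /andP[s0 s1]; have := J_ge0 x0; have := J_ge0 (x0 + d t).
  set m := mu t in mt *; set j := J x0; set k := J (_ + d t).
  move=> k0 j0 cvx sub.
  have q0 : 0 <= m^-1 * q by rewrite mulr_ge0// invr_ge0 ltW.
  have qm : q = m * (m^-1 * q) by rewrite mulVKf ?gt_eqF.
  split.
    apply: le_trans cvx _; have := ler_wpM2l s0 sub; have := mulr_ge0 s0 q0.
    by lra.
  rewrite qm (_ : s t * _ = m * (s t * s t * (m^-1 * q))); last by ring.
  rewrite ler_pM2l//.
  have ss : s t * s t * (m^-1 * q) <= s t * (m^-1 * q).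
    by rewrite ler_wpM2r// ler_piMr.
  have := ler_wpM2l s0 sub; have := mulr_ge0 s0 k0.
  have := ler_wpM2r j0 s1; lra.
have ae : dot (a t) (e t) @[t --> F] --> (0 : R).
  rewrite (_ : 0 = dot 0 e'); first exact: cvg_dot.
  by rewrite dotE trmx0 mul0mx mxE.
have Jae : J x0 + dot (a t) (e t) @[t --> F] --> J x0.
  by rewrite -[X in _ --> X](addr0 (J x0)); apply: cvgD => //; exact: cvg_cst.
have Je : J (x0 + e') <= J x0.
  have lim : J (x0 + e t) @[t --> F] --> J (x0 + e').
    apply: continuous_cvg; first exact: (convex_continuous J_convex).
    by apply: cvgD => //; exact: cvg_cst.
  by apply: (ler_cvg_near lim Jae); apply: filterS bounds => t [].
(* As [mu] tends to 0, the second bound forces the limit form to be nonpositive at [e']. *)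
have Ge : Gt *m e' = 0.
  apply: psd_dot_eq0; [exact: limit_sym|exact: limit_psd|].
  have lim : dot (G t *m e t) (e t) @[t --> F] --> dot (Gt *m e') e'.
    by apply: cvg_dot => //; exact: cvg_mulmx.
  have lim0 : mu t * (J x0 + dot (a t) (e t)) @[t --> F] --> (0 : R).
    by rewrite -(mul0r (J x0)); exact: cvgM.
  by apply: (ler_cvg_near lim lim0); apply: filterS bounds => t [].
have [_ x0_min] : argmin [set x | Gt *m x = Gt *m x0] J x0 by rewrite x0_unique.
have : [set x0] (x0 + e').
  rewrite -x0_unique; split=> [/=|z Gz]; first by rewrite mulmxDr Ge addr0.
  exact: le_trans Je (x0_min z Gz).
rewrite -[X in [set X] _]addr0 => /addrI e'0.
have : r <= `|e'|.
  by apply: (ler_cvg_near (cvg_cst r) (cvg_norm ee')); apply: filterS e_r => t ->.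
by rewrite e'0 normr0 leNgt r0.
Qed.

Variable M : set 'cV[R]_p.
Hypothesis Mx0 : M x0.
Hypothesis M_tangent : is_tangent_space M x0 (model_space J x0).
Hypothesis ker_Gt : [set v | Gt *m v = 0] `&` model_space J x0 = [set 0].
Hypothesis Md : \forall t \near F, M (x0 + d t).

Lemma cvg_secant_model c (w : 'cV[R]_p) :
  c t *: d t @[t --> F] --> w -> model_space J x0 w.
Proof.
move=> cdw; have [k [f [feq Tf]]] := M_tangent.
by rewrite Tf /=; apply: (cvg_secant_tangent feq Mx0 displacement_cvg0 Md cdw).
Qed.

Lemma x0_d_cvg : x0 + d t @[t --> F] --> x0.
Proof.
rewrite -[X in _ --> X](addr0 x0); apply: cvgD; first exact: cvg_cst.
exact: displacement_cvg0.
Qed.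

(* Otherwise the normalised displacements converge to a unit vector of the
   tangent model space, which the boundedness of the subgradients puts in the
   kernel of [Gt]. *)
Lemma scaled_displacement_bounded :
  exists b : R, \forall t \near F, `|(mu t)^-1 *: d t| <= b.
Proof.
apply: contrapT => unbounded.
pose v t := (mu t)^-1 *: d t.
have large b : \forall t \near F, b < `|v t|.
  have [vb|] := in_ultra_setVsetC [set t | `|v t| <= b] FU.
    by case: unbounded; exists b.
  by apply: filterS => t /negP; rewrite -ltNge.
pose c t := `|v t|^-1 * (mu t)^-1.
have c1 : \forall t \near F, `|c t *: d t| = 1.
  apply: filterS (large 0) => t v0.
  by rewrite -scalerA normrZ ger0_norm ?invr_ge0// mulVf ?gt_eqF.
have [w cdw] : exists w : 'cV[R]_p, c t *: d t @[t --> F] --> w.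
  by apply: (@ultra_bounded_cvg _ _ _ _ _ _ _ 1); apply: filterS c1 => t ->.
have w1 : 1 <= `|w|.
  by apply: (ler_cvg_near (cvg_cst (1 : R)) (cvg_norm cdw)); apply: filterS c1 => t ->.
have [b hb] := subgradient_bound J_convex (`|x0| + 1).
have eta_b : \forall t \near F, `|a t - G t *m v t| <= b.
  have xd : \forall t \near F, `|x0 + d t| <= `|x0| + 1.
    by apply: (cvgr_norm_le _ x0_d_cvg); rewrite ltrDl.
  apply: filterS2 xd d_subdiff => t xdt sub.
  by apply: (hb (x0 + d t)) => //; rewrite /v -scalemxAr.
have Gw : Gt *m w = 0.
  apply/eqP; rewrite -normr_le0; apply/ler_addgt0Pr => e e0; rewrite add0r.
  have lim : G t *m (c t *: d t) @[t --> F] --> Gt *m w by exact: cvg_mulmx.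
  apply: (ler_cvg_near (cvg_norm lim) (cvg_cst e)).
  have a1 : \forall t \near F, `|a t| <= 1 by exact: cvgr0_norm_le.
  have b0 : 0 <= `|b| + 1 by rewrite addr_ge0.
  (* Since [G t *m v t] has norm at most [1 + |b|], dividing by a norm of [v t] above this threshold
     leaves at most [e]. *)
  apply: filterS3 a1 eta_b (large ((`|b| + 1) / e)) => t at1 etab.
  rewrite ltr_pdivrMr// => vt.
  have v0 : 0 < `|v t| by rewrite -(pmulr_lgt0 _ e0) (le_lt_trans b0).
  rewrite -scalerA -/(v t) -scalemxAr normrZ ger0_norm ?invr_ge0//.
  rewrite mulrC ler_pdivrMr// mulrC.
  apply: le_trans (ltW vt); rewrite -[G t *m _](subKr (a t)).
  apply: le_trans (ler_normB _ _) _; rewrite addrC lerD//.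
  exact: le_trans etab (ler_norm b).
have : [set 0] w by rewrite -ker_Gt; split=> //; exact: cvg_secant_model cdw.
by move=> w0; move: w1; rewrite w0 normr0 ler10.
Qed.

Lemma linearized_precertificate_subdiff :
  subdiff J x0 (linearized_precertificate J x0 Gt).
Proof.
have [b vb] := scaled_displacement_bounded.
have [v vv] := ultra_bounded_cvg vb.
have sub : subdiff J x0 (- (Gt *m v)).
  apply: (subdiff_closed J_convex x0_d_cvg _ d_subdiff).
  rewrite -[X in _ --> X]sub0r; apply: cvgB => //.
  by under eq_fun do rewrite scalemxAr; exact: cvg_mulmx.
rewrite (linearized_precertificateE limit_sym limit_psd ker_Gt _ sub)//.
exact: cvg_secant_model vv.
Qed.

End LimitingArgument.

(** * Canonical parameters, and the passage from failing constants to an ultrafilter *)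

Lemma canonical_parameter_sym (R : realType) p (x0 : 'cV[R]_p) mu u G :
  canonical_parameter x0 mu u G -> G^T = G.
Proof.
by move=> [n [Phi [w [l [_ _ _ ->]]]]]; rewrite linearZ/= trmx_mul trmxK.
Qed.

Lemma canonical_parameter_psd (R : realType) p (x0 : 'cV[R]_p) mu u G v :
  canonical_parameter x0 mu u G -> 0 <= dot (G *m v) v.
Proof.
move=> [n [Phi [w [l [_ _ _ ->]]]]]; rewrite -scalemxAl dotZl -mulmxA dot_mulmxl trmxK.
by rewrite mulr_ge0 ?dot_ge0// invr_ge0 ler0n.
Qed.

Theorem proposition1 (R : realType) (p : nat) (x0 : 'cV[R]_p)
    (J : 'cV[R]_p -> R) (M : set 'cV[R]_p) (Gt : 'M[R]_p)
    (J_ge0 : forall x, 0 <= J x)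
    (J_convex : convex_function setT J)
    (Mx0 : M x0)
    (J_smooth : locally_partly_smooth J M x0)
    (x0_unique : argmin [set x | Gt *m x = Gt *m x0] J = [set x0])
    (ker_Gt : [set v | Gt *m v = 0] `&` model_space J x0 = [set 0])
    (eta_Gt : ~ subdiff J x0 (linearized_precertificate J x0 Gt)) :
  exists2 C : R, 0 < C &
    forall (mu : R) (u : 'cV[R]_p) (G : 'M[R]_p),
      canonical_parameter x0 mu u G -> 0 < mu ->
      let eps := u - G *m x0 in
      Num.max (Num.max (opnorm (G - Gt)) (norm2 eps * mu^-1)) mu <= C ->
      forall x, argmin setT (objective J mu u G) x -> ~ M x.
Proof.
apply: contrapT => noC; apply: eta_Gt.
have M_tangent : is_tangent_space M x0 (model_space J x0).
  by have [_ [U x0U /(_ x0 Mx0 (nbhs_singleton x0U))[]]] := J_smooth.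
(* [B C] gathers the counterexamples to the constant [C]. If no constant works, these nested sets
   are nonempty for all positive [C] and generate a proper filter, which extends to an
   ultrafilter. *)
pose B (C : R) := [set t : R * 'cV[R]_p * 'M[R]_p * 'cV[R]_p |
  let: (mu, u, G, x) := t in
  [/\ canonical_parameter x0 mu u G, 0 < mu,
      [/\ opnorm (G - Gt) <= C, norm2 (u - G *m x0) * mu^-1 <= C & mu <= C],
      argmin setT (objective J mu u G) x & M x]].
pose F0 := filter_from [set C : R | 0 < C] B.
have F0_filter : Filter F0.
  apply: filter_from_filter => [|C D C0 D0]; first by exists 1 => /=.
  exists (Num.min C D) => [|[[[mu u] G] x] /=]; first by rewrite /= lt_min C0.
  by rewrite !le_min => -[? ? [/andP[? ?] /andP[? ?] /andP[? ?]] ? ?].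
have F0_proper : ProperFilter F0.
  apply: filter_from_proper => C C0; apply: contrapT => noB.
  apply: noC; exists C => // mu u G can mu0 eps; rewrite !ge_max -andbA => /and3P[h1 h2 h3].
  by move=> x xmin Mx; apply: noB; exists (mu, u, G, x).
have [F [FU F0F]] := ultraFilterLemma F0_proper.
have FB C : 0 < C -> F (B C) by move=> C0; apply: F0F; exists C.
pose mu (t : R * 'cV[R]_p * 'M[R]_p * 'cV[R]_p) := t.1.1.1.
pose G (t : R * 'cV[R]_p * 'M[R]_p * 'cV[R]_p) := t.1.2.
pose a (t : R * 'cV[R]_p * 'M[R]_p * 'cV[R]_p) := (mu t)^-1 *: (t.1.1.2 - G t *m x0).
pose d (t : R * 'cV[R]_p * 'M[R]_p * 'cV[R]_p) := t.2 - x0.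
apply: (@linearized_precertificate_subdiff _ _ _ F _ J x0 Gt J_convex mu G a d)
  (M) _ _ _ _ => //.
- by apply: filterS (FB 1 ltr01) => -[[[m u] A] x] [].
- apply/cvgr0Pnorm_le => e e0; apply: filterS (FB e e0) => -[[[m u] A] x].
  by move=> [_ m0 [_ _ me] _ _]; rewrite /mu/= gtr0_norm.
- apply: filterS (FB 1 ltr01) => -[[[m u] A] x] [can _ _ _ _].
  exact: canonical_parameter_sym can.
- apply: filterS (FB 1 ltr01) => -[[[m u] A] x] [can _ _ _ _] w.
  exact: canonical_parameter_psd can.
- apply/cvgrPdist_le => e e0; apply: filterS (FB e e0) => -[[[m u] A] x].
  move=> [_ _ [Ae _ _] _ _]; rewrite distrC; exact: le_trans (norm_le_opnorm _) Ae.
- apply/cvgr0Pnorm_le => e e0; apply: filterS (FB e e0) => -[[[m u] A] x].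
  move=> [_ m0 [_ ue _] _ _]; rewrite /a /mu /G /= normrZ gtr0_norm ?invr_gt0//.
  by rewrite mulrC; apply: le_trans ue; rewrite ler_pM2r ?invr_gt0// norm_le_norm2.
(* Splitting [u - G x] as [(u - G x0) - G (x - x0)] turns the optimality condition into the required
   form. *)
- apply: filterS (FB 1 ltr01) => -[[[m u] A] x] [can m0 _ xmin _].
  rewrite /a /d /mu /G /= addrC subrK -scalerBr mulmxBr opprB addrA subrK.
  exact: argmin_objective_subdiff (canonical_parameter_sym can) xmin.
- by apply: filterS (FB 1 ltr01) => -[[[m u] A] x] [_ _ _ _ Mx]; rewrite /d/= addrC subrK.
Qed.
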